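(* Let $\Delta,d$ be positive integers with $d>\Delta$ and let $c\in[\frac12,1)$. Let $G$ be a connected graph with maximum degree at most $\Delta$, let $w$ be a normal weight function on $G$, and assume $G$ has no $(w,c)$-balanced separator of size at most $d$. Let $\mathcal{C}$ be a clique covering of $G$ (equipped with any anchor map), let $\beta_{\mathcal{C}}$ be the central bag for $\mathcal{C}$ and $w_{\mathcal{C}}$ the weight function on $\beta_{\mathcal{C}}$. Then (i) $\beta_{\mathcal{C}}$ has no $(w_{\mathcal{C}},c)$-balanced separator of size at most $d(1+\Delta)^{-1}$, and (ii) $\beta_{\mathcal{C}}$ has no clique cutset.
   Context: A weight function $w:V(G)\to\mathbb{R}_{\ge0}$ is extended to sets by summation; normal means total weight 1. For a graph $H$ with weight function $w'$, $X\subseteq V(H)$ is a $(w',c)$-balanced separator of $H$ if every component $D$ of $H\setminus X$ has $w'(D)\le c$; size is $|X|$. A separation is a triple $S=(A(S),C(S),B(S))$ of pairwise disjoint sets with union $V(G)$ and $A(S)$ anticomplete to $B(S)$. Fix an ordering of $V(G)$, inducing a lexicographic order on subsets. A clique cutset of a connected graph is a clique whose removal disconnects it. For a clique cutset $K$ of $G$, the clique separation $S_K=(A_K,C_K,B_K)$ has $B_K$ the lexicographically minimum largest-weight component of $G\setminus K$, $C_K=K$, $A_K=V(G)\setminus(B_K\cup K)$. $S_1$ is a shield for $S_2$ if $B(S_1)\cup C(S_1)\subseteq B(S_2)\cup C(S_2)$; a sequence is primordial if no member is a shield for a different member. A clique covering is a primordial sequence $\mathcal{C}$ of clique separations such that every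 clique separation of $G$ has a shield in $\mathcal{C}$. For a sequence $\mathcal{S}=(S_1,\dots,S_k)$, $S_i=(A_i,C_i,B_i)$, the central bag is $\beta_{\mathcal{S}}=\bigcap_i(B_i\cup C_i)$; an anchor map picks $\mathrm{anchor}(S_i)\in C_i$; with $w^*(A_i)=w(A_i\setminus\bigcup_{j<i}A_j)$ the weight function on $\beta_{\mathcal{S}}$ is $w_{\mathcal{S}}(v)=w(v)+\sum_{i:\mathrm{anchor}(S_i)=v}w^*(A_i)$. *)

(* Defs.v *)
From mathcomp Require Import all_boot all_order all_algebra.
From mathcomp Require Import reals.

Set Implicit Arguments.
Unset Strict Implicit.
Unset Printing Implicit Defensive.

Import Order.TTheory GRing.Theory Num.Theory.

Local Open Scope ring_scope.

Record sgraph (V : finType) := SGraph {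
  adj :> rel V;
  adj_sym : symmetric adj;
  adj_irrefl : irreflexive adj
}.

Section Graphs.
Variables (V : finType) (G : sgraph V).

Definition neighbors (v : V) : {set V} := [set u | G v u].

Definition max_degree : nat := (\max_(v : V) #|neighbors v|)%N.

Definition is_clique (K : {set V}) : bool :=
  [forall x in K, forall y in K, (x != y) ==> G x y].

Definition anticomplete (X Y : {set V}) : bool :=
  [forall x in X, forall y in Y, ~~ G x y].

(* An induced subgraph of [G] is represented by its vertex set [U]. *)
Definition induced (U : {set V}) : rel V :=
  [rel x y | [&& x \in U, y \in U & G x y]].

Definition connected_in (U : {set V}) : Prop :=
  {in U &, forall x y, connect (induced U) x y}.

Definition components (U : {set V}) : {set {set V}} :=
  equivalence_partition (connect (induced U)) U.

(* The empty set is a clique, so a disconnected [G[U]] has the clique cutset  *)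
(* [set0]; when [G[U]] is connected every clique cutset is nonempty.          *)
Definition clique_cutset (U K : {set V}) : Prop :=
  [/\ K \subset U, is_clique K & ~ connected_in (U :\: K)].

Definition is_separation (A C B : {set V}) : bool :=
  [&& [disjoint A & C], [disjoint A & B], [disjoint C & B],
      A :|: C :|: B == [set: V] & anticomplete A B].

Record separation := Separation {
  sepA : {set V};
  sepC : {set V};
  sepB : {set V};
  sepP : is_separation sepA sepC sepB
}.

Definition shield (S1 S2 : separation) : Prop :=
  sepB S1 :|: sepC S1 \subset sepB S2 :|: sepC S2.

(* "Different" members are members with different values: repeating an entry  *)
(* of the sequence is allowed.                                                *)
Definition primordial (k : nat) (S : 'I_k -> separation) : Prop :=
  forall i j : 'I_k, S i <> S j -> ~ shield (S i) (S j).

Definition central_bag (k : nat) (S : 'I_k -> separation) : {set V} :=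
  \bigcap_(i < k) (sepB (S i) :|: sepC (S i)).

Definition anchor_map (k : nat) (S : 'I_k -> separation) (anchor : 'I_k -> V) :
    Prop :=
  forall i : 'I_k, anchor i \in sepC (S i).

End Graphs.

Section Weights.
Variables (R : realType) (V : finType) (G : sgraph V).

Definition weight_function (w : V -> R) : Prop := forall v, 0 <= w v.

Definition wset (w : V -> R) (X : {set V}) : R := \sum_(v in X) w v.

Definition normal_weight (w : V -> R) : Prop :=
  weight_function w /\ wset w [set: V] = 1.

(* Only the values of [w] on [U] matter. *)
Definition balanced_separator (U : {set V}) (w : V -> R) (c : R)
    (X : {set V}) : Prop :=
  X \subset U /\ {in components G (U :\: X), forall D, wset w D <= c}.

Definition has_balanced_separator (U : {set V}) (w : V -> R) (c s : R) : Prop :=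
  exists X : {set V}, balanced_separator U w c X /\ #|X|%:R <= s.

Definition wstar (w : V -> R) (k : nat) (S : 'I_k -> separation G) (i : 'I_k) :
    R :=
  wset w (sepA (S i) :\: \bigcup_(j < k | (j < i)%N) sepA (S j)).

Definition bag_weight (w : V -> R) (k : nat) (S : 'I_k -> separation G)
    (anchor : 'I_k -> V) (v : V) : R :=
  w v + \sum_(i < k | anchor i == v) wstar w S i.

End Weights.

(* The ordering of the vertices is the one carried by the [finOrderType] [V]. *)
Section CliqueSeparations.
Variables (R : realType) (disp : Order.disp_t) (V : finOrderType disp).
Variables (G : sgraph V) (w : V -> R).

Definition lexkey (X : {set V}) : seqlexi V := sort <=%O (enum X).

Definition largest_component (U D : {set V}) : Prop :=
  D \in components G U /\ {in components G U, forall D', wset w D' <= wset w D}.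

Definition lexmin_largest_component (U D : {set V}) : Prop :=
  largest_component U D /\
  forall D', largest_component U D' -> (lexkey D <= lexkey D')%O.

(* [S] is [S_K]. *)
Definition clique_separation_of (K : {set V}) (S : separation G) : Prop :=
  [/\ lexmin_largest_component (~: K) (sepB S), sepC S = K
    & sepA S = ~: (sepB S :|: K)].

Definition clique_separation (S : separation G) : Prop :=
  exists2 K : {set V}, clique_cutset G [set: V] K & clique_separation_of K S.

Definition clique_covering (k : nat) (S : 'I_k -> separation G) : Prop :=
  [/\ primordial S, forall i : 'I_k, clique_separation (S i)
    & forall S' : separation G,
        clique_separation S' -> exists i : 'I_k, shield (S i) S'].

End CliqueSeparations.

(* Main.v *)
(* A clique has at most Delta + 1 <= d vertices, so removing it leaves exactly *)
(* one component of weight > c.  In a clique covering every vertex of C_i has  *)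
(* a neighbour in the heavy component B_i, and this forces C_i to avoid every  *)
(* A_j; hence all the cliques C_i lie in the central bag, and vertices of the  *)
(* bag connected in G \ X are connected in the bag minus X, for any X.         *)
(* For (ii), a clique cutset K of the bag would be one of G, and a shield of   *)
(* S_K in the covering puts the bag minus K inside the connected set B_K.      *)
(* For (i), a balanced separator X of the bag would make N[X] a balanced       *)
(* separator of G: a component D of G \ N[X] either lies in some A_i, of       *)
(* weight < 1 - c <= c, or meets the bag inside one component Q of the bag     *)
(* minus X, in which case Q contains the anchor of each A_i met by D, since    *)
(* this anchor is equal or adjacent to a vertex of D in C_i.                   *)
Require Import Defs.
From mathcomp Require Import all_boot all_order all_algebra.
From mathcomp Require Import boolp reals lra.

Set Implicit Arguments.
Unset Strict Implicit.
Unset Printing Implicit Defensive.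

Import Order.TTheory GRing.Theory Num.Theory.

Local Open Scope ring_scope.

(** By [G_nosep], deleting at most [d] vertices always leaves a component heavier than [c]; it is
    unique because [c] is at least one half. For a clique cutset it is therefore the [B]-side of the
    clique separation ([clique_separation_exists]). The covering and primordial conditions together
    make each member of [C] minimal for shields. Minimality yields [covering_attached], and from it
    [covering_noncrossing]: the cliques [C_i] all lie in the bag. Hence whatever lies outside the
    bag hangs on it through cliques of the bag, and detours outside can be replaced by clique edges
    ([central_bag_connect]). Both claims then transfer from the bag to [G]. In (i), [X] is enlarged
    to its closed neighbourhood so that a component of the rest meeting both the bag and [A_i]
    cannot have the anchor of [A_i] in [X]. *)

Lemma connect_invariant (T : finType) (e : rel T) (P : T -> Prop) (x y : T) :
  (forall u v, P u -> e u v -> P v) -> P x -> connect e x y -> P y.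
Proof.
move=> eP Px /connectP[p]; elim: p x Px => [|z p IHp] x Px /=; first by move=> _ ->.
by case/andP=> xz zp yE; apply: (IHp z) => //; apply: eP xz.
Qed.

(** * Components, separations and cliques *)

Section Components.
Variables (V : finType) (G : sgraph V).
Implicit Types (U D K X : {set V}) (S : separation G).

Lemma induced_sym U : symmetric (induced G U).
Proof. by move=> x y; rewrite /induced /= adj_sym andbCA. Qed.

Lemma connect_induced_sym U x y :
  connect (induced G U) x y = connect (induced G U) y x.
Proof. exact/sym_connect_sym/induced_sym. Qed.

Lemma components_sub U D : D \in components G U -> D \subset U.
Proof. by case/imsetP=> x xU ->; apply/subsetP=> y; rewrite inE => /andP[]. Qed.

Lemma components_neq0 U D : D \in components G U -> exists x, x \in D.
Proof. by case/imsetP=> x xU ->; exists x; rewrite inE xU connect0. Qed.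

Lemma mem_components U D x y : D \in components G U -> x \in D ->
  (y \in D) = (y \in U) && connect (induced G U) x y.
Proof.
case/imsetP=> z zU ->; rewrite !inE => /andP[xU zx]; congr (_ && _).
by apply: same_connect zx y; apply: connect_induced_sym.
Qed.

Lemma components_cover U x : x \in U ->
  exists2 D, D \in components G U & x \in D.
Proof.
move=> xU; exists [set y in U | connect (induced G U) x y].
  by apply/imsetP; exists x.
by rewrite inE xU connect0.
Qed.

Lemma components_eq U D D' x : D \in components G U -> D' \in components G U ->
  x \in D -> x \in D' -> D = D'.
Proof.
by move=> DU D'U xD xD'; apply/setP=> y;
  rewrite (mem_components _ DU xD) (mem_components _ D'U xD').
Qed.

Lemma components_adj U D x y : D \in components G U ->
  x \in D -> y \in U -> G x y -> y \in D.
Proof.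
move=> DU xD yU xy; rewrite (mem_components _ DU xD) yU /=; apply: connect1.
by rewrite /induced /= yU xy (subsetP (components_sub DU)).
Qed.

Lemma components_connect U D U' x y : D \in components G U -> D \subset U' ->
  x \in D -> y \in D -> connect (induced G U') x y.
Proof.
move=> DU sDU' xD yD.
have: connect (induced G U) x y by move: yD; rewrite (mem_components _ DU xD) => /andP[].
suff inv: forall u v, u \in D /\ connect (induced G U') x u -> induced G U u v ->
    v \in D /\ connect (induced G U') x v.
  by move=> /(connect_invariant inv)[] //; split.
move=> u v [uD xu] /and3P[uU vU uv]; have vD := components_adj DU uD vU uv.
by split=> //; apply: connect_trans xu _; apply: connect1; rewrite /induced /= uv !(subsetP sDU').
Qed.

Lemma components_sub_components U D U' : D \in components G U -> D \subset U' ->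
  exists2 D', D' \in components G U' & D \subset D'.
Proof.
move=> DU sDU'; have [x xD] := components_neq0 DU.
have [D' D'U' xD'] := components_cover (subsetP sDU' _ xD).
exists D' => //; apply/subsetP=> y yD; rewrite (mem_components _ D'U' xD').
by rewrite (subsetP sDU') //=; exact: (components_connect DU).
Qed.

(** This keeps a heavy side [B_i] a component after its clique is shrunk. *)
Lemma components_closed U D U' : D \in components G U -> D \subset U' ->
  (forall x y, x \in D -> y \in U' -> G x y -> y \in D) -> D \in components G U'.
Proof.
move=> DU sDU' clD; have [D' D'U' sDD'] := components_sub_components DU sDU'.
suff -> : D = D' by [].
apply/eqP; rewrite eqEsubset sDD'; apply/subsetP=> y yD'.
have [x xD] := components_neq0 DU.
move: yD'; rewrite (mem_components _ D'U' (subsetP sDD' _ xD)) => /andP[_].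
by apply: (@connect_invariant _ _ (fun z => z \in D)) => // u v uD /and3P[_ vU' uv];
  apply: clD uv.
Qed.

Lemma mem_sepA S x : (x \in sepA S) = (x \notin sepB S :|: sepC S).
Proof.
have /and5P[dAC dAB _ /eqP/setP/(_ x)] := sepP S; rewrite !inE => cov _; move: cov.
case: (boolP (x \in sepA S)) => [xA _|_ /=].
  by rewrite (disjointFr dAC xA) (disjointFr dAB xA).
by rewrite orbC => ->.
Qed.

Lemma sep_adj S x y : x \in sepA S -> G x y -> y \notin sepA S -> y \in sepC S.
Proof.
move=> xA xy; have /and5P[_ _ _ _ anti] := sepP S.
rewrite mem_sepA negbK inE => /orP[yB|//].
by move/forall_inP/(_ x xA)/forall_inP/(_ y yB)/negP: anti; case.
Qed.

Lemma clique_adj K x y : is_clique G K -> x \in K -> y \in K -> x != y -> G x y.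
Proof. by move=> /forall_inP/(_ x)/[swap] xK /(_ xK)/forall_inP/(_ y)/[swap] yK /(_ yK)/implyP. Qed.

Lemma clique_sub K K' : K' \subset K -> is_clique G K -> is_clique G K'.
Proof.
move=> sK clK; apply/forall_inP=> x xK; apply/forall_inP=> y yK; apply/implyP.
by apply: clique_adj clK _ _; apply: (subsetP sK).
Qed.

Lemma card_neighbors_le v : (#|neighbors G v| <= max_degree G)%N.
Proof. exact: (leq_bigmax v). Qed.

Lemma clique_card K : is_clique G K -> (#|K| <= (max_degree G).+1)%N.
Proof.
move=> clK; have [->|[x xK]] := set_0Vmem K; first by rewrite cards0.
have sK : K \subset x |: neighbors G x.
  apply/subsetP=> y yK; rewrite !inE; case: eqVneq => //= neq_yx.
  by apply: clique_adj clK _ _ _ => //; rewrite eq_sym.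
apply: leq_trans (subset_leq_card sK) _.
by rewrite cardsU1 inE adj_irrefl /= add1n ltnS card_neighbors_le.
Qed.

Definition closed_nbhd X : {set V} := \bigcup_(x in X) (x |: neighbors G x).

Lemma closed_nbhd_card X : (#|closed_nbhd X| <= #|X| * (max_degree G).+1)%N.
Proof.
rewrite -sum_nat_const; apply: (big_ind2 (fun (Y : {set V}) n => #|Y| <= n)%N) => [|Y m Z n|x _].
- by rewrite cards0.
- by move=> leYm leZn; apply: leq_trans (leq_card_setU _ _) (leq_add leYm leZn).
by rewrite cardsU1 inE adj_irrefl /= add1n ltnS card_neighbors_le.
Qed.

Lemma sub_closed_nbhd X : X \subset closed_nbhd X.
Proof. by apply/subsetP=> x xX; apply/bigcupP; exists x => //; rewrite setU11. Qed.

Lemma closed_nbhd_adj X x y : x \in X -> G x y -> y \in closed_nbhd X.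
Proof. by move=> xX xy; apply/bigcupP; exists x => //; rewrite !inE xy orbT. Qed.

End Components.

(** * Connectivity inside the central bag *)

Section CentralBag.
Variables (V : finType) (G : sgraph V) (k : nat) (S : 'I_k -> separation G).

Lemma central_bagPn x : reflect (exists i, x \in sepA (S i)) (x \notin central_bag S).
Proof.
apply: (iffP idP) => [|[i xA]].
  move=> /negP nx; apply/existsP; apply: contra_notT nx => /existsPn nA.
  by apply/bigcapP=> i _; rewrite -[_ \in _]negbK -mem_sepA nA.
by apply/negP=> /bigcapP/(_ i isT); apply/negP; rewrite -mem_sepA.
Qed.

Lemma central_bag_notA i x : x \in central_bag S -> x \notin sepA (S i).
Proof. by apply: contraL => xA; apply/central_bagPn; exists i. Qed.

Hypothesis C_clique : forall i, is_clique G (sepC (S i)).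
Hypothesis C_bag : forall i, sepC (S i) \subset central_bag S.

(* A walk can only leave the bag through a vertex of some clique [C_i] and    *)
(* come back through a vertex of the same clique.                             *)
Lemma central_bag_connect (X : {set V}) x y :
    x \in central_bag S -> y \in central_bag S -> x \notin X ->
  connect (induced G (~: X)) x y -> connect (induced G (central_bag S :\: X)) x y.
Proof.
move=> xb yb xX; set e := induced G (_ :\: _).
(* While the walk is in [A_i], the invariant remembers a vertex [u] of [C_i] reached inside the bag.
   On return at a vertex of [C_i], that vertex is [u] or adjacent to it. *)
pose P z := (z \in central_bag S -> connect e x z) /\
  forall i, z \in sepA (S i) -> exists u, [/\ u \in sepC (S i), u \notin X & connect e x u].
suff inv u v : P u -> induced G (~: X) u v -> P v.
  move=> /(connect_invariant inv)[|+ _]; last exact.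
  by split=> // i xA; have := central_bag_notA i xb; rewrite xA.
move=> [Pb PA] /and3P[]; rewrite !inE => uX vX uv; split=> [vb|i vA].
  have [ub|/central_bagPn[i uA]] := boolP (u \in central_bag S).
    by apply: connect_trans (Pb ub) _; apply: connect1; rewrite /e /induced /= !inE uX vX ub vb.
  have [t [tC tX xt]] := PA i uA; have vC := sep_adj uA uv (central_bag_notA i vb).
  have [<- //|neq_tv] := eqVneq t v.
  apply: connect_trans xt _; apply: connect1.
  by rewrite /e /induced /= !inE tX vX (subsetP (C_bag i)) // vb (clique_adj (C_clique i)).
have [uA|uA] := boolP (u \in sepA (S i)); first exact: PA.
have uC : u \in sepC (S i) by apply: sep_adj vA _ uA; rewrite adj_sym.
by exists u; split=> //; apply: Pb; apply: (subsetP (C_bag i)).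
Qed.

End CentralBag.

(** * Weights of sets and of the bag *)

Section Weights.
Variables (R : realType) (V : finType) (G : sgraph V) (w : V -> R).
Hypothesis w_ge0 : weight_function w.
Implicit Types (X Y D : {set V}).

Lemma wset_ge0 X : 0 <= wset w X.
Proof. by apply: sumr_ge0 => v _. Qed.

Lemma wsetID X Y : wset w X = wset w (X :&: Y) + wset w (X :\: Y).
Proof. exact: big_setID. Qed.

Lemma wset_sub X Y : X \subset Y -> wset w X <= wset w Y.
Proof. by move/setIidPr=> XY; rewrite (wsetID Y X) XY lerDl wset_ge0. Qed.

Lemma wsetU_disjoint X Y : [disjoint X & Y] -> wset w (X :|: Y) = wset w X + wset w Y.
Proof. by move=> dXY; rewrite /wset -bigU //; apply: eq_bigl => v; rewrite !inE. Qed.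

Lemma wsetU_le X Y : wset w (X :|: Y) <= wset w X + wset w Y.
Proof.
rewrite (wsetID _ X) setUK setDUl setDv set0U lerD2l.
exact/wset_sub/subsetDl.
Qed.

Lemma wset_bigcup_le (I : finType) (P : pred I) (E : I -> {set V}) :
  wset w (\bigcup_(i | P i) E i) <= \sum_(i | P i) wset w (E i).
Proof.
apply: (big_ind2 (fun X s => wset w X <= s)) => [|X s Y t Xs Yt|i _ //].
  by rewrite /wset big_set0.
exact: le_trans (wsetU_le _ _) (lerD Xs Yt).
Qed.

(** Each [wstar w S i] is carried by the single vertex [anchor i], so the double sum regroups by
    anchor. *)
Lemma wset_bag_weight k (S : 'I_k -> separation G) (anchor : 'I_k -> V) X :
  wset (bag_weight w S anchor) X =
  wset w X + \sum_(i < k | anchor i \in X) wstar w S i.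
Proof.
rewrite /wset /bag_weight big_split /=; congr (_ + _).
rewrite [RHS](partition_big anchor (fun v => v \in X)) //=.
apply: eq_bigr => v vX; apply: eq_bigl => i.
by case: eqVneq => [->|]; rewrite ?vX ?andbF.
Qed.

End Weights.

(** * Components heavier than [c] *)

Section Heavy.
Variables (R : realType) (disp : Order.disp_t) (V : finOrderType disp).
Variables (G : sgraph V) (Delta d : nat) (c : R) (w : V -> R).
Hypotheses (ltDelta_d : (Delta < d)%N) (c_range : 2^-1 <= c < 1).
Hypothesis G_degree : (max_degree G <= Delta)%N.
Hypothesis w_normal : normal_weight w.
Hypothesis G_nosep : ~ has_balanced_separator G [set: V] w c d%:R.
Implicit Types (U D K X : {set V}) (S : separation G).

Let w_ge0 : weight_function w := w_normal.1.

(** Disjoint sets would have total weight above [2 * c], hence above 1. *)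
Lemma heavy_meet X Y : c < wset w X -> c < wset w Y -> exists2 x, x \in X & x \in Y.
Proof.
move=> wX wY; have [dXY|] := boolP [disjoint X & Y]; last first.
  by case/pred0Pn=> x /andP[xX xY]; exists x.
have := wset_sub w_ge0 (subsetT (X :|: Y)).
rewrite wsetU_disjoint // w_normal.2; case/andP: c_range; lra.
Qed.

Lemma heavy_component X : (#|X| <= d)%N ->
  exists2 D, D \in components G (~: X) & c < wset w D.
Proof.
move=> Xd; apply/exists_inP; apply: contraT => /exists_inPn noD.
case: G_nosep; exists X; split; last by rewrite ler_nat.
by split; rewrite ?subsetT // setTD => D /noD; rewrite -leNgt.
Qed.

Lemma heavy_component_clique K : is_clique G K ->
  exists2 D, D \in components G (~: K) & c < wset w D.
Proof.
move=> /clique_card K_le; apply: heavy_component.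
by apply: leq_trans K_le _; apply: leq_ltn_trans ltDelta_d.
Qed.

Lemma heavy_component_unique U D D' : D \in components G U -> D' \in components G U ->
  c < wset w D -> c < wset w D' -> D = D'.
Proof. by move=> DU D'U wD wD'; have [x] := heavy_meet wD wD'; apply: (components_eq DU). Qed.

Lemma clique_separation_exists K D : clique_cutset G [set: V] K ->
    D \in components G (~: K) -> c < wset w D ->
  exists2 S : separation G, clique_separation_of w K S & sepB S = D /\ sepC S = K.
Proof.
move=> [_ clK ncon] DK wD.
have sDK := components_sub DK.
have sepS : is_separation G (~: (D :|: K)) K D.
  apply/and5P; split.
  - by rewrite disjoints_subset setCS subsetUr.
  - by rewrite disjoints_subset setCS subsetUl.
  - by rewrite disjoint_sym disjoints_subset.
  - by rewrite -setUA [K :|: D]setUC setUC setUCr.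
  apply/forall_inP=> x; rewrite !inE negb_or => /andP[xD xK].
  apply/forall_inP=> y yD; apply: contra xD; rewrite adj_sym.
  by apply: components_adj DK yD _; rewrite inE.
exists (Separation sepS) => //; split=> //=; split.
  (* Uniqueness of the heavy component makes [D] the only largest one, so the lexicographic minimum
     is [D]. *)
  split=> // D' D'K; have [wD'|wD'] := leP (wset w D') c; first exact: ltW (le_lt_trans wD' wD).
  by rewrite (heavy_component_unique DK D'K).
move=> D' [D'K maxD']; rewrite (heavy_component_unique DK D'K) //.
by apply: lt_le_trans wD _; apply: maxD'.
Qed.

Lemma clique_separation_heavy S : clique_separation w S ->
  [/\ is_clique G (sepC S), sepB S \in components G (~: sepC S) & c < wset w (sepB S)].
Proof.
case=> K [_ clK _] [[[BK maxB] _] -> _]; split=> //.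
have [D DK wD] := heavy_component_clique clK.
exact: lt_le_trans wD (maxB D DK).
Qed.

(** * Structure of a clique covering *)

Section Covering.
Variables (k : nat) (C : 'I_k -> separation G).
Hypothesis C_covering : clique_covering w C.

Let C_heavy i : [/\ is_clique G (sepC (C i)),
  sepB (C i) \in components G (~: sepC (C i)) & c < wset w (sepB (C i))].
Proof. by apply: clique_separation_heavy; case: C_covering => _ /(_ i). Qed.

(** Members of a covering are minimal: some [C j] shields [S], hence also [C i] by transitivity, and
    primordiality forces [C j = C i]. *)
Let C_shield i S : clique_separation w S -> shield S (C i) -> shield (C i) S.
Proof.
case: C_covering => prim _ cov /cov[j jS] Si.
have ji : shield (C j) (C i) by apply: subset_trans jS Si.
suff <- : C j = C i by [].
by case: (pselect (C j = C i)) => // /prim.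
Qed.

(* Otherwise the vertices of [C_i] with a neighbour in [B_i] would form a     *)
(* smaller clique cutset whose separation shields [S_i].                      *)
Lemma covering_attached i v : v \in sepC (C i) -> exists2 u, u \in sepB (C i) & G u v.
Proof.
move=> vC; apply/exists_inP; apply: contraT => nv.
have [clK BK wB] := C_heavy i.
set K := sepC (C i) in clK BK vC *; set B := sepB (C i) in BK wB nv.
pose K' := [set x in K | [exists u in B, G u x]].
have sK' : K' \subset K by apply/subsetP=> x; rewrite inE => /andP[].
have vK' : v \notin K' by rewrite inE (negPf nv) andbF.
have clB x y : x \in B -> y \in ~: K' -> G x y -> y \in B.
  rewrite !inE negb_and => xB /orP[yK|/exists_inPn/(_ x xB)/negP//] xy.
  by apply: components_adj BK xB _ xy; rewrite inE.
have BK' : B \in components G (~: K').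
  by apply: (components_closed BK _ clB); apply: subset_trans (components_sub BK) _; rewrite setCS.
have vB : v \notin B by apply/negP=> /(subsetP (components_sub BK)); rewrite inE vC.
have cutK' : clique_cutset G [set: V] K'.
  split; [exact: subsetT|exact: clique_sub clK|].
  have [b bB] := components_neq0 BK => /(_ b v); rewrite setTD !inE.
  have := subsetP (components_sub BK') b bB; rewrite !inE => -> /(_ isT).
  move: vK'; rewrite inE => -> /(_ isT) bv.
  by case/negP: vB; rewrite (mem_components _ BK' bB) !inE bv (negPf nv) !andbF.
have [S SK' [SB SC]] := clique_separation_exists cutK' BK' wB.
have /subsetP/(_ v) : shield (C i) S.
  by apply: C_shield; [exists K'|rewrite /shield SB SC setUS].
by rewrite SB SC in_setU vC orbT in_setU (negPf vB) (negPf vK') => /(_ isT).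
Qed.

(** If [v] were in [A_j], the clique [C_i] would miss [B_j], so the connected heavy set [B_j] would
    lie in [B_i]. As each vertex of [C_j] has a neighbour in [B_j], [C j] would shield [C i]; by
    minimality [C i] shields [C j], so [v] is in [B_j] or [C_j], a contradiction. *)
Lemma covering_noncrossing i j v : v \in sepC (C i) -> v \notin sepA (C j).
Proof.
move=> vC; apply/negP=> vA.
have [clKi BKi wBi] := C_heavy i; have [clKj BKj wBj] := C_heavy j.
have anti u : u \in sepC (C i) -> u \notin sepB (C j).
  move=> uC; apply/negP=> uB; have /and5P[_ dAB _ _ _] := sepP (C j).
  have uA : u \notin sepA (C j) by rewrite (disjointFl dAB uB).
  have vu : G v u by apply: clique_adj clKi _ _ _ => //; apply: contraNneq uA => <-.
  have := sep_adj vA vu uA.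
  by move/(subsetP (components_sub BKj)): uB; rewrite inE => /negP.
have sBj : sepB (C j) \subset ~: sepC (C i).
  by apply/subsetP=> u uB; rewrite inE; apply: contraL uB; apply: anti.
have [D DKi sBD] := components_sub_components BKj sBj.
have DE : D = sepB (C i).
  apply: heavy_component_unique DKi BKi _ wBi.
  exact: lt_le_trans wBj (wset_sub w_ge0 sBD).
have sh : shield (C j) (C i).
  apply/subsetP=> u; rewrite in_setU => /orP[uB|uC].
    by rewrite in_setU -DE (subsetP sBD).
  rewrite in_setU; case: (boolP (u \in sepC (C i))) => [_|uCi]; first by rewrite orbT.
  have [t tB tu] := covering_attached uC.
  by rewrite -DE (components_adj DKi (subsetP sBD _ tB) _ tu) // inE.
have Cj : clique_separation w (C j) by case: C_covering => _ /(_ j).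
have /subsetP/(_ v) := C_shield Cj sh.
by rewrite in_setU vC orbT => /(_ isT); apply/negP; rewrite -mem_sepA.
Qed.

Lemma covering_clique i : is_clique G (sepC (C i)).
Proof. by case: (C_heavy i). Qed.

Lemma covering_bag i : sepC (C i) \subset central_bag C.
Proof.
apply/subsetP=> v vC; apply: contraT => /central_bagPn[j].
by rewrite (negPf (covering_noncrossing j vC)).
Qed.

(** * Clique cutsets of the bag *)

Lemma central_bag_no_clique_cutset K : ~ clique_cutset G (central_bag C) K.
Proof.
case=> sK clK; apply=> x y; rewrite !inE => /andP[xK xb] /andP[yK yb].
apply: (central_bag_connect covering_clique covering_bag) => //.
have [D DK wD] := heavy_component_clique clK.
have [con|ncon] := pselect (connected_in G (~: K)).
  by apply: con; rewrite inE.
have cutK : clique_cutset G [set: V] K by split; rewrite ?subsetT ?setTD.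
have [S SK [SB SC]] := clique_separation_exists cutK DK wD.
have [i sh] : exists i, shield (C i) S.
  by case: C_covering => _ _; apply; exists K.
(* The bag lies in [B_i] and [C_i] together, and the shield puts these inside [D :|: K]. *)
have inD z : z \in central_bag C -> z \notin K -> z \in D.
  move=> /bigcapP/(_ i isT)/(subsetP sh); rewrite SB SC in_setU.
  by case/orP=> [//|->].
by have := inD y yb yK; rewrite (mem_components _ DK (inD x xb xK)) => /andP[].
Qed.

(** * Balanced separators of the bag *)

Lemma wset_sepA_le i : wset w (sepA (C i)) <= c.
Proof.
have [_ _ wB] := C_heavy i; have /and5P[_ dAB _ _ _] := sepP (C i).
have := wset_sub w_ge0 (subsetT (sepA (C i) :|: sepB (C i))).
rewrite wsetU_disjoint // w_normal.2; case/andP: c_range; lra.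
Qed.

Lemma central_bag_no_balanced_separator (anchor : 'I_k -> V) :
    anchor_map C anchor ->
  ~ has_balanced_separator G (central_bag C) (bag_weight w C anchor) c
      (d%:R * (1 + Delta%:R)^-1).
Proof.
move=> C_anchor [X [[sX balX] cardX]].
set N := closed_nbhd G X.
have Nd : (#|N| <= d)%N.
  apply: leq_trans (closed_nbhd_card G X) _.
  apply: (@leq_trans (#|X| * Delta.+1)); first by rewrite leq_mul2l ltnS G_degree orbT.
  move: cardX; rewrite ler_pdivlMr ?ltr_wpDr // nat1r -natrM ler_nat.
  exact.
have [D DN] := heavy_component Nd; apply/negP; rewrite -leNgt.
(* [D] is connected, so it cannot leave [A_i] without meeting [C_i]. *)
have leave i v x : v \in D -> v \in sepA (C i) -> x \in D -> x \notin sepA (C i) ->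
    exists2 u, u \in D & u \in sepC (C i).
  move=> vD vA xD xA; apply/exists_inP; apply: contraR xA => /exists_inPn nC.
  have: connect (induced G (~: N)) v x.
    by move: xD; rewrite (mem_components _ DN vD) => /andP[].
  have inv a b : a \in D /\ a \in sepA (C i) -> induced G (~: N) a b ->
      b \in D /\ b \in sepA (C i).
    move=> [aD aA] /and3P[_ bN ab]; have bD := components_adj DN aD bN ab.
    by split=> //; apply: contraNT (nC b bD); apply: sep_adj ab.
  by move/(connect_invariant inv)=> [].
have [/exists_inP[x xD xb]|/exists_inPn noD] := boolP [exists x in D, x \in central_bag C];
  last first.
  (* If [D] misses the bag, it misses every [C_i] and stays inside one [A_i]. *)
  have [v vD] := components_neq0 DN.
  have /central_bagPn[i vA] := noD v vD.
  apply: le_trans (wset_sepA_le i); apply: wset_sub => //.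
  apply/subsetP=> x xD; apply: contraT => xA.
  have [u uD uC] := leave i v x vD vA xD xA.
  by move: (noD u uD); rewrite (subsetP (covering_bag i)).
have notX y : y \in D -> y \notin X.
  move/(subsetP (components_sub DN)); rewrite inE; apply: contra.
  exact: (subsetP (sub_closed_nbhd G X)).
have xU : x \in central_bag C :\: X by rewrite inE xb notX.
have [Q QU xQ] := components_cover G xU.
have inQ y : y \in D -> y \in central_bag C -> y \in Q.
  move=> yD yb; rewrite (mem_components _ QU xQ) inE yb notX //=.
  apply: (central_bag_connect covering_clique covering_bag) => //; first exact: notX.
  apply: (components_connect DN) => //.
  by apply/subsetP=> z zD; rewrite inE notX.
have anchorQ i v : v \in D -> v \in sepA (C i) -> anchor i \in Q.
  move=> vD vA.
  have [u uD uC] := leave i v x vD vA xD (central_bag_notA i xb).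
  have uQ : u \in Q by apply: inQ uD (subsetP (covering_bag i) _ uC).
  have [<- //|neq] := eqVneq u (anchor i).
  have ua := clique_adj (covering_clique i) uC (C_anchor i) neq.
  apply: (components_adj QU uQ _ ua); rewrite inE (subsetP (covering_bag i)) ?C_anchor // andbT.
  (* An anchor in [X] would put its neighbour [u] in [N], which [D] avoids. *)
  apply/negP=> aX; have /(subsetP (components_sub DN)) := uD.
  by rewrite inE (closed_nbhd_adj aX) // adj_sym.
(* Inside the bag [D] is part of [Q]; outside, its weight is bounded by the [wstar] terms anchored
   in [Q]. *)
apply: le_trans (balX Q QU); rewrite wset_bag_weight (wsetID _ _ (central_bag C)).
apply: lerD; first by apply: wset_sub => //; apply/subsetP=> y /setIP[]; apply: inQ.
apply: le_trans (wset_bigcup_le w_ge0 _ _); apply: wset_sub => //.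
apply/subsetP=> v /setDP[vD /central_bagPn[i0 vA0]].
(* The least index [i] with [v] in [A_i] is the one whose [wstar] counts [v]. *)
case: (@arg_minnP _ i0 (fun i => v \in sepA (C i)) val vA0) => i vA min_i.
apply/bigcupP; exists i; first exact: anchorQ vA.
rewrite inE vA andbT; apply/bigcupP=> -[j lt_ji vAj].
by have := min_i j vAj; rewrite leqNgt lt_ji.
Qed.

End Covering.
End Heavy.

Theorem theorem2p12 (R : realType) (disp : Order.disp_t)
    (V : finOrderType disp) (G : sgraph V) (Delta d : nat) (c : R)
    (w : V -> R) (k : nat) (C : 'I_k -> separation G) (anchor : 'I_k -> V)
    (Delta_gt0 : (0 < Delta)%N) (d_gt0 : (0 < d)%N) (ltDelta_d : (Delta < d)%N)
    (c_range : 2^-1 <= c < 1)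
    (G_connected : connected_in G [set: V])
    (G_degree : (max_degree G <= Delta)%N)
    (w_normal : normal_weight w)
    (G_nosep : ~ has_balanced_separator G [set: V] w c d%:R)
    (C_covering : clique_covering w C)
    (C_anchor : anchor_map C anchor) :
  ~ has_balanced_separator G (central_bag C) (bag_weight w C anchor) c
      (d%:R * (1 + Delta%:R)^-1)
  /\ ~ (exists K : {set V}, clique_cutset G (central_bag C) K).
Proof.
split.
  exact: (central_bag_no_balanced_separator ltDelta_d c_range G_degree w_normal
            G_nosep C_covering C_anchor).
case=> K.
exact: (central_bag_no_clique_cutset ltDelta_d c_range G_degree w_normal
          G_nosep C_covering).
Qed.
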